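(* Let $d\in\{2,3\}$, let $\alpha^2\in\mathbb C$ be a non-zero constant (with $\alpha^4:=(\alpha^2)^2$), let $\mathrm{Re}\neq 0$ be a constant, and let $\boldsymbol f\in[\mathcal P_N]^d$. Then there exists a vector polynomial $\boldsymbol g\in[\mathcal P_{N+2}]^d$ satisfying componentwise $$(\Delta^3-\alpha^4\Delta)\boldsymbol g=\boldsymbol f\quad\text{in }\mathbb R^d,$$ and for any such $\boldsymbol g$ the pair $$\boldsymbol u=(\Delta+\alpha^2)\big(\Delta\boldsymbol g-\nabla(\operatorname{div}\boldsymbol g)\big),\qquad p=-\frac{1}{\mathrm{Re}}(\Delta^2-\alpha^4)(\operatorname{div}\boldsymbol g)$$ belongs to $[\mathcal P_N]^d\times\mathcal P_{N+1}$ and solves the linearized Navier–Stokes (Brinkman) system $$(\Delta-\alpha^2)\boldsymbol u-\mathrm{Re}\,\nabla p=\boldsymbol f,\qquad \operatorname{div}\boldsymbol u=0\quad\text{in }\mathbb R^d.$$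
   Context: $\mathcal P_N$ denotes the space of all $d$-variate polynomials (complex coefficients) of total degree at most $N\in\mathbb N_0$. $\Delta$ acts componentwise on vector fields. $\mathrm{Re}$ denotes the (constant) Reynolds number. *)

(* Defs.v *)
From HB Require Import structures.
From mathcomp Require Import all_boot all_order all_algebra.
From mathcomp Require Import reals complex mpoly.

Set Implicit Arguments.
Unset Strict Implicit.
Unset Printing Implicit Defensive.

Import GRing.Theory.
Local Open Scope ring_scope.

(* Polynomials are formal and are differentiated formally: over R[i] a
   polynomial is determined by its values on R^d, so an identity between
   polynomials "in R^d" is an equality in {mpoly R[i][d]}. *)

Definition vpoly (K : nzRingType) (d : nat) := {ffun 'I_d -> {mpoly K[d]}}.

(* P_N. Here msize p is 1 + the total degree of p, and msize 0 = 0. *)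
Definition polyN (K : nzRingType) (d N : nat) (p : {mpoly K[d]}) : bool :=
  (msize p <= N.+1)%N.

(* [P_N]^d *)
Definition vpolyN (K : nzRingType) (d N : nat) (v : vpoly K d) : bool :=
  [forall i, polyN N (v i)].

Definition lapl (K : nzRingType) (d : nat) (p : {mpoly K[d]}) : {mpoly K[d]} :=
  \sum_(i < d) (p^`M(i))^`M(i).

Definition vlapl (K : nzRingType) (d : nat) (v : vpoly K d) : vpoly K d :=
  [ffun i => lapl (v i)].

Definition grad (K : nzRingType) (d : nat) (p : {mpoly K[d]}) : vpoly K d :=
  [ffun i => p^`M(i)].

Definition divg (K : nzRingType) (d : nat) (v : vpoly K d) : {mpoly K[d]} :=
  \sum_(i < d) (v i)^`M(i).

(* (Delta^3 - alpha^4 Delta) g, with a2 standing for alpha^2 *)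
Definition L6 (K : nzRingType) (d : nat) (a2 : K) (g : vpoly K d) : vpoly K d :=
  iter 3 (@vlapl K d) g - a2 ^+ 2 *: vlapl g.

(* (Delta + alpha^2) (Delta g - grad (div g)) *)
Definition velocity (K : nzRingType) (d : nat) (a2 : K) (g : vpoly K d) :
    vpoly K d :=
  let w : vpoly K d := vlapl g - grad (divg g) in vlapl w + a2 *: w.

(* - (1 / Re) (Delta^2 - alpha^4) (div g) *)
Definition pressure (K : fieldType) (d : nat) (a2 Rey : K) (g : vpoly K d) :
    {mpoly K[d]} :=
  - (1 / Rey) *: (iter 2 (@lapl K d) (divg g) - a2 ^+ 2 *: divg g).

(* Main.v *)
Require Import Defs.
From HB Require Import structures.
From mathcomp Require Import all_boot all_order all_algebra.
From mathcomp Require Import reals complex mpoly.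
From mathcomp Require Import zify.
Local Open Scope ring_scope.
Local Open Scope complex_scope.

Import GRing.Theory Num.Theory.

Set Implicit Arguments.
Unset Strict Implicit.
Unset Printing Implicit Defensive.

(** All the operators involved are polynomials in the partial derivatives, so
    they commute.  Write w for Delta g - grad (div g).  Then div w vanishes
    because div grad is Delta ([divg_grad]), and hence so does the divergence
    of u.  In the momentum equation (Delta - a2) (Delta + a2) is
    Delta^2 - a2^2, and the gradient of the pressure contributes exactly the
    (Delta^2 - a2^2) grad (div g) that was subtracted in w; what remains is
    (Delta^2 - a2^2) Delta g ([brinkman_momentum]).

    Existence of g is a componentwise, scalar question.  The Laplacian maps
    P_(n+2) onto P_n ([lapl_surj]): dividing by the coefficient of the
    derivative along one chosen axis solves Delta g = X^m up to monomials of
    the same degree with a larger exponent on this axis, and that exponent is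
    bounded by the degree.  For Delta^3 - b Delta with b nonzero
    ([L6_scalar_surj]), the leading part is the term of lowest order: if
    Delta g0 = - p / b, then g0 solves the equation up to the error
    Delta^2 p / b, which has smaller degree than p, so an induction on the
    degree finishes. *)

(** * Linearity and commutation of the differential operators *)

Lemma lapl_is_linear (K : nzRingType) (d : nat) : linear (@lapl K d).
Proof.
move=> c p q; rewrite /lapl scaler_sumr -big_split /=.
by apply/eq_bigr => i _; rewrite !linearP.
Qed.

HB.instance Definition _ (K : nzRingType) (d : nat) :=
  GRing.isLinear.Build K {mpoly K[d]} {mpoly K[d]} _ (@lapl K d)
    (@lapl_is_linear K d).

Lemma laplD (K : nzRingType) (d : nat) (p q : {mpoly K[d]}) :
  lapl (p + q) = lapl p + lapl q.
Proof. exact: linearD. Qed.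

Lemma laplZ (K : nzRingType) (d : nat) (c : K) (p : {mpoly K[d]}) :
  lapl (c *: p) = c *: lapl p.
Proof. exact: linearZ. Qed.

Lemma mderiv_lapl (K : nzRingType) (d : nat) (i : 'I_d) (p : {mpoly K[d]}) :
  (lapl p)^`M(i) = lapl p^`M(i).
Proof.
rewrite /lapl raddf_sum; apply/eq_bigr => j _ /=.
by rewrite !(mderiv_comm j i).
Qed.

Lemma divg_is_linear (K : nzRingType) (d : nat) : linear (@divg K d).
Proof.
move=> c u v; rewrite /divg scaler_sumr -big_split /=.
by apply/eq_bigr => i _; rewrite !ffunE linearP.
Qed.

HB.instance Definition _ (K : nzRingType) (d : nat) :=
  GRing.isLinear.Build K {ffun 'I_d -> {mpoly K[d]}} {mpoly K[d]} _
    (@divg K d) (@divg_is_linear K d).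

Lemma divg_vlapl (K : nzRingType) (d : nat) (v : vpoly K d) :
  divg (vlapl v) = lapl (divg v).
Proof.
rewrite /divg linear_sum; apply/eq_bigr => i _.
by rewrite ffunE mderiv_lapl.
Qed.

Lemma divg_grad (K : nzRingType) (d : nat) (p : {mpoly K[d]}) :
  divg (grad p) = lapl p.
Proof. by apply/eq_bigr => i _; rewrite ffunE. Qed.

(** * Degree bounds *)

(** The spaces P_N, indexed by a bound on the size, one more than the degree:
    the bound 0 is then the zero space, where inductions on the degree start.
    As a collective predicate it inherits the closure lemmas of submodules. *)
Definition msize_le (K : nzRingType) (d n : nat) : {pred {mpoly K[d]}} :=
  fun p => (msize p <= n)%N.
Arguments msize_le {K d} n.

Lemma msize_le_submod (K : nzRingType) (d n : nat) :
  submod_closed (@msize_le K d n).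
Proof.
split=> [|c p q]; rewrite ?unfold_in /msize_le ?mmeasure0 // => hp hq.
rewrite (leq_trans (msizeD_le _ _)) // geq_max.
by rewrite (leq_trans (msizeZ_le _ _)).
Qed.

HB.instance Definition _ (K : nzRingType) (d n : nat) :=
  GRing.isSubmodClosed.Build K {mpoly K[d]} (@msize_le K d n)
    (@msize_le_submod K d n).

Lemma msize_leW (K : nzRingType) (d m n : nat) (p : {mpoly K[d]}) :
  (m <= n)%N -> p \in msize_le m -> p \in msize_le n.
Proof. by move=> mn; rewrite !unfold_in => /leq_trans; apply. Qed.

Lemma mderiv_msize_le (K : nzRingType) (d n : nat) (i : 'I_d)
  (p : {mpoly K[d]}) : p \in msize_le n.+1 -> p^`M(i) \in msize_le n.
Proof.
move=> hp; rewrite /mderiv big_seq; apply: rpred_sum => m hm.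
have [->|mi] := eqVneq (m i) 0%N; first by rewrite mul0r scale0r rpred0.
apply: rpredZ; rewrite unfold_in /msize_le msizeX.
have hlt := leq_trans (msize_mdeg_lt hm) hp.
rewrite -(submK (m := U_(i)%MM) (m' := m)) ?lep1mP // mdegD mdeg1 in hlt.
by rewrite addn1 in hlt.
Qed.

Lemma lapl_msize_le (K : nzRingType) (d n : nat) (p : {mpoly K[d]}) :
  p \in msize_le n.+2 -> lapl p \in msize_le n.
Proof. by move=> hp; apply: rpred_sum => i _; do 2 apply: mderiv_msize_le. Qed.

Lemma lapl_preserves_msize_le (K : nzRingType) (d n : nat) (p : {mpoly K[d]}) :
  p \in msize_le n -> lapl p \in msize_le n.
Proof. by move=> hp; apply/lapl_msize_le/(msize_leW _ hp); lia. Qed.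

(** * Surjectivity of the Laplacian *)

(** The image under Delta of the polynomials of size at most n + 2, a subspace:
    monomials can therefore be treated one by one. *)
Definition lapl_solvable (K : nzRingType) (d n : nat) (p : {mpoly K[d]}) :=
  exists2 g, g \in msize_le n.+2 & lapl g = p.

Lemma lapl_solvable0 (K : nzRingType) (d n : nat) :
  lapl_solvable n (0 : {mpoly K[d]}).
Proof. by exists 0; rewrite ?rpred0 ?linear0. Qed.

Lemma lapl_solvableP (K : nzRingType) (d n : nat) (c : K) (p q : {mpoly K[d]}) :
  lapl_solvable n p -> lapl_solvable n q -> lapl_solvable n (c *: p + q).
Proof.
move=> [g hg <-] [h hh <-]; exists (c *: g + h); last exact: linearP.
by rewrite rpredD // rpredZ.
Qed.

(** Only terms with a nonzero coefficient need solving: in the second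
    derivatives of a monomial, the others carry a truncated exponent that is
    meaningless. *)
Lemma lapl_solvable_sum (K : nzRingType) (d n : nat) (I : eqType) (r : seq I)
    (P : pred I) (c : I -> K) (F : I -> {mpoly K[d]}) :
  (forall i, i \in r -> P i -> c i != 0 -> lapl_solvable n (F i)) ->
  lapl_solvable n (\sum_(i <- r | P i) c i *: F i).
Proof.
move=> hF; rewrite big_seq_cond; elim/big_rec: _ => [|i q /andP[ir Pi] hq].
  exact: lapl_solvable0.
have [->|ci] := eqVneq (c i) 0; first by rewrite scale0r add0r.
exact/lapl_solvableP/hq/hF.
Qed.

Lemma mderiv2X (K : nzRingType) (d : nat) (i : 'I_d) (m : 'X_{1..d}) :
  'X_[K, m]^`M(i)^`M(i) = (m i * (m i).-1)%:R *: 'X_[m - U_(i) - U_(i)].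
Proof.
by rewrite mderivX linearZ /= mderivX scalerA -natrM mnmBE mnm1E eqxx subn1.
Qed.

(** Let M be m with the exponent along i0 raised by two.  Then Delta X^M is a
    nonzero multiple of X^m (characteristic 0) plus monomials of the same
    degree in which the exponent along i0 is that of M, two more than in m.
    The induction is on the part of the degree that lies on the other axes,
    which decreases. *)
Lemma lapl_solvableX (K : fieldType) (d : nat) (i0 : 'I_d) (m : 'X_{1..d}) :
  [pchar K] =i pred0 -> lapl_solvable (mdeg m).+1 'X_[K, m].
Proof.
move=> /pcharf0P charK0.
have [k] := ubnP (mdeg m - m i0)%N; elim: k m => // k IHk m hk.
pose M := (m + U_(i0) + U_(i0))%MM.
have Mi0 : M i0 = (m i0).+2 by rewrite !mnmDE mnm1E eqxx !addn1.
have degM : mdeg M = (mdeg m).+2 by rewrite !mdegD mdeg1 !addn1.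
pose c : K := (M i0 * (M i0).-1)%:R.
have c0 : c != 0 by rewrite charK0 Mi0.
pose rest := \sum_(j < d | j != i0)
  (M j * (M j).-1)%:R *: 'X_[K, M - U_(j) - U_(j)].
have laplXM : lapl 'X_[K, M] = c *: 'X_[m] + rest.
  rewrite /lapl (bigD1 i0) //= mderiv2X; congr (_ *: 'X_[_] + _).
    by rewrite !addmK.
  by apply/eq_bigr => j _; rewrite mderiv2X.
have -> : 'X_[m] = (- c^-1) *: rest + c^-1 *: lapl 'X_[K, M].
  by rewrite laplXM scalerDr scalerA mulVf // scale1r scaleNr addrCA addNr addr0.
apply: lapl_solvableP; last first.
  exists (c^-1 *: 'X_[M]); last by rewrite linearZ.
  by rewrite rpredZ // unfold_in /msize_le msizeX degM.
apply: lapl_solvable_sum => j _ ji0.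
rewrite charK0 muln_eq0 negb_or => /andP[Mj Mj1].
(* A nonzero coefficient means M j >= 2, so the subtraction is not truncated. *)
set m' := (M - _ - _)%MM.
have Ej : (U_(j) <= M)%MM by rewrite lep1mP.
have Ej' : (U_(j) <= M - U_(j))%MM.
  by rewrite lep1mP mnmBE mnm1E eqxx subn1.
have EM : M = (m' + U_(j) + U_(j))%MM by rewrite !submK.
have degm' : mdeg m' = mdeg m.
  by move: degM; rewrite EM !mdegD mdeg1 !addn1 => -[].
have m'i0 : m' i0 = (m i0).+2.
  by rewrite -Mi0 EM !mnmDE mnm1E (negPf ji0) !addn0.
have le_m' : (m' i0 <= mdeg m')%N.
  by rewrite mdegE (bigD1 i0) //= leq_addr.
rewrite -degm'; apply: IHk; lia.
Qed.

Lemma lapl_surj (K : fieldType) (d n : nat) (i0 : 'I_d) (p : {mpoly K[d]}) :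
  [pchar K] =i pred0 -> p \in msize_le n ->
  exists2 g, g \in msize_le n.+2 & lapl g = p.
Proof.
move=> charK0 hp; rewrite [p]mpolyE; apply: lapl_solvable_sum => m hm _ _.
have [g hg <-] := lapl_solvableX i0 m charK0; exists g => //.
by apply: msize_leW hg; rewrite !ltnS (leq_trans (msize_mdeg_lt hm)).
Qed.

(** * Existence of the potential *)

(** Delta is nilpotent on polynomials, so - b Delta dominates: the term
    Delta^3 g0 is an error of smaller degree, absorbed by induction. *)
Lemma L6_scalar_surj (K : fieldType) (d n : nat) (i0 : 'I_d) (b : K)
    (p : {mpoly K[d]}) :
  [pchar K] =i pred0 -> b != 0 -> p \in msize_le n ->
  exists2 g, g \in msize_le n.+2 & lapl (lapl (lapl g)) - b *: lapl g = p.
Proof.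
move=> charK0 b0; elim: n p => [|n IHn] p hp.
  have -> : p = 0 by apply/eqP; rewrite -msize_poly_eq0 -leqn0.
  by exists 0; rewrite ?rpred0 // !linear0 addr0.
have [|g0 hg0 lapl_g0] := lapl_surj (n := n.+1) i0 (p := - b^-1 *: p) charK0.
  exact/rpredZ/hp.
have [|g1 hg1 L_g1] := IHn (b^-1 *: lapl (lapl p)).
  apply/rpredZ/lapl_preserves_msize_le/lapl_msize_le.
  by apply: msize_leW hp.
exists (g0 + g1); first by rewrite rpredD //; apply: msize_leW hg1.
rewrite !laplD scalerDr opprD addrACA [X in _ + X]L_g1 lapl_g0 !laplZ.
by rewrite scalerA mulrN mulfV // !scaleNr scale1r opprK addrAC addNr add0r.
Qed.

Lemma L6E (K : nzRingType) (d : nat) (a2 : K) (g : vpoly K d) (i : 'I_d) :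
  L6 a2 g i = lapl (lapl (lapl (g i))) - a2 ^+ 2 *: lapl (g i).
Proof. by rewrite /L6 /= !ffunE. Qed.

Lemma L6_surj (K : fieldType) (d N : nat) (a2 : K) (f : vpoly K d) :
  (0 < d)%N -> [pchar K] =i pred0 -> a2 != 0 -> vpolyN N f ->
  exists g : vpoly K d, vpolyN (N + 2) g /\ L6 a2 g = f.
Proof.
move=> d0 charK0 a0 /forallP hf.
have solve i : exists g : {mpoly K[d]}, (g \in msize_le N.+3) &&
    (lapl (lapl (lapl g)) - a2 ^+ 2 *: lapl g == f i).
  have [g hg Lg] := L6_scalar_surj (Ordinal d0) charK0
    (expf_neq0 2 a0) (hf i).
  by exists g; rewrite hg Lg /=.
exists [ffun i => xchoose (solve i)]; split.
  apply/forallP => i; rewrite ffunE addn2.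
  by have /andP[] := xchooseP (solve i).
apply/ffunP => i; rewrite L6E ffunE; apply/eqP.
by have /andP[] := xchooseP (solve i).
Qed.

(** * The velocity and the pressure *)

Lemma velocity_vpolyN (K : nzRingType) (d N : nat) (a2 : K) (g : vpoly K d) :
  vpolyN (N + 2) g -> vpolyN N (velocity a2 g).
Proof.
move=> /forallP; rewrite /polyN addn2 => hg.
apply/forallP => i; rewrite /velocity !ffunE.
set w := lapl (g i) - _.
have hw : w \in msize_le N.+1.
  apply: rpredB; first exact/lapl_msize_le/hg.
  apply/mderiv_msize_le/rpred_sum => j _; exact/mderiv_msize_le/hg.
exact: (rpredD (lapl_preserves_msize_le hw) (rpredZ a2 hw)).
Qed.

Lemma pressure_polyN (K : fieldType) (d N : nat) (a2 Rey : K) (g : vpoly K d) :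
  vpolyN (N + 2) g -> polyN (N + 1) (pressure a2 Rey g).
Proof.
move=> /forallP; rewrite /polyN addn2 addn1 => hg.
have hdiv : divg g \in msize_le N.+2.
  by apply/rpred_sum => j _; exact/mderiv_msize_le/hg.
suff : pressure a2 Rey g \in msize_le N.+2 by [].
apply: rpredZ; apply: rpredB; last exact: rpredZ.
by do 2 apply: lapl_preserves_msize_le.
Qed.

Lemma divg_velocity (K : nzRingType) (d : nat) (a2 : K) (g : vpoly K d) :
  divg (velocity a2 g) = 0.
Proof.
have divw : divg (vlapl g - grad (divg g)) = 0.
  by rewrite linearB /= divg_vlapl divg_grad subrr.
by rewrite linearD linearZ /= divg_vlapl divw linear0 scaler0 addr0.
Qed.

Lemma lapl_difference_of_squares (K : nzRingType) (d : nat) (a : K)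
    (w : {mpoly K[d]}) :
  lapl (lapl w + a *: w) - a *: (lapl w + a *: w)
  = lapl (lapl w) - a ^+ 2 *: w.
Proof. by rewrite linearD linearZ /= scalerDr scalerA -expr2 addrKA. Qed.

(** With T = Delta^2 - a2^2 and q the i-th derivative of div g, the i-th
    component reads T (Delta g_i - q) + T q = T (Delta g_i). *)
Lemma brinkman_momentum (K : fieldType) (d : nat) (a2 Rey : K)
    (g : vpoly K d) : Rey != 0 ->
  vlapl (velocity a2 g) - a2 *: velocity a2 g
    - Rey *: grad (pressure a2 Rey g) = L6 a2 g.
Proof.
move=> Re0; apply/ffunP => i; rewrite L6E !ffunE.
rewrite lapl_difference_of_squares /pressure /= mderivZ mderivB mderivZ.
rewrite !mderiv_lapl.
rewrite scalerA mulrN mulrCA mulfV // mulr1 scaleN1r opprK.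
by rewrite addrACA -opprD -scalerDr -!laplD subrK.
Qed.

Theorem mainTheorem5 (R : realType) (d N : nat) (hd : d = 2%N \/ d = 3%N)
    (a2 Rey : R[i]) (ha2 : a2 != 0) (hRey : Rey != 0)
    (f : vpoly R[i] d) (hf : vpolyN N f) :
  (exists g : vpoly R[i] d, vpolyN (N + 2) g /\ L6 a2 g = f) /\
  (forall g : vpoly R[i] d, vpolyN (N + 2) g -> L6 a2 g = f ->
     let u := velocity a2 g in
     let p := pressure a2 Rey g in
     [/\ vpolyN N u, polyN (N + 1) p,
         vlapl u - a2 *: u - Rey *: grad p = f
       & divg u = 0]).
Proof.
split; first by apply: L6_surj hf; [case: hd => -> | exact: pchar_num |].
move=> g hg Lg u p; split.
- exact: velocity_vpolyN.
- exact: pressure_polyN.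
- by rewrite brinkman_momentum.
- exact: divg_velocity.
Qed.
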